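(* Let $A,B\in\mathbb{S}^n$ and suppose $A$ is invertible. Then $\{A,B\}$ is ASDC if and only if $A^{-1}B$ has real eigenvalues (i.e., all eigenvalues of $A^{-1}B$ are real).
   Context: $\mathbb{S}^n$ denotes the real vector space of $n\times n$ real symmetric matrices. A set $\mathcal{A}\subseteq\mathbb{S}^n$ is simultaneously diagonalizable via congruence (SDC) if there exists an invertible $P\in\mathbb{R}^{n\times n}$ such that $P^\top A P$ is diagonal for all $A\in\mathcal{A}$. A set $\mathcal{A}\subseteq\mathbb{S}^n$ is almost simultaneously diagonalizable via congruence (ASDC) if there exist sequences $A_i\to A$ in $\mathbb{S}^n$, one for every $A\in\mathcal{A}$, such that for every $i\in\mathbb{N}$ the set $\{A_i : A\in\mathcal{A}\}$ is SDC. *)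

(* Defs.v *)
(* MathComp-Analysis for the topology of 'M[R]_n, mathcomp-real-closed for the
   complex numbers R[i]. *)
From HB Require Import structures.
From mathcomp Require Import all_boot all_order all_algebra.
From mathcomp Require Import complex.
From mathcomp Require Import all_classical all_reals all_analysis.

Set Implicit Arguments.
Unset Strict Implicit.
Unset Printing Implicit Defensive.

Import Order.TTheory GRing.Theory Num.Theory.
Import numFieldNormedType.Exports.

Local Open Scope classical_set_scope.
Local Open Scope ring_scope.

Definition SDC (R : realType) (n : nat) (S : set 'M[R]_n) : Prop :=
  exists2 P : 'M[R]_n, P \in unitmx &
    forall A, S A -> is_diag_mx (P^T *m A *m P).

(* The approximating sequence of A is u A; the values of u outside S are
   irrelevant. The limit is the entrywise one on 'M[R]_n. *)
Definition ASDC (R : realType) (n : nat) (S : set 'M[R]_n) : Prop :=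
  exists u : 'M[R]_n -> nat -> 'M[R]_n,
    [/\ forall A, S A -> forall i, u A i \is symmetricmx,
        forall A, S A -> u A i @[i --> \oo] --> A
      & forall i, SDC [set u A i | A in S]].

(* [eigenvalue] only sees eigenvalues in the base field, so the real matrix M
   is first viewed as a complex one: the quantifier then ranges over all of
   its complex eigenvalues. *)
Definition has_real_eigenvalues (R : realType) (n : nat) (M : 'M[R]_n) : Prop :=
  forall a : R[i], eigenvalue (map_mx (real_complex R) M) a -> a \is Num.real.

(* Main.v *)
Require Import Defs.
From mathcomp Require Import all_boot all_order all_algebra.
From mathcomp Require Import complex.
From mathcomp Require Import all_classical all_reals all_analysis.
From mathcomp Require Import ring.

Set Implicit Arguments.
Unset Strict Implicit.
Unset Printing Implicit Defensive.

Import ComplexField.Normc.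
Import Order.TTheory GRing.Theory Num.Theory.
Import numFieldNormedType.Exports.

Local Open Scope classical_set_scope.
Local Open Scope ring_scope.
Local Notation toC := (map_mx (real_complex _)).
(* The cast selects the topology that R[i] has as a numeric field. *)
Local Notation Cfield R := (R[i] : numFieldType).

(** The pair [A, B] is studied through the pencil $zA - B$, whose roots are the
    eigenvalues of $A^{-1}B$ and which behaves well under congruence.

    Necessity.  If [A, B] is SDC, then a diagonalizing congruence turns
    $B - zA$ into a diagonal matrix with entries $b_j - z a_j$, each of modulus
    at least $|Im z| |a_j|$; hence $|det (B - zA)| >= |Im z|^n |det A|$
    ([SDC_det_lower_bound]).  Both sides are continuous in $(A, B)$, so the bound
    survives the passage to limits of SDC pairs.  When $A$ is invertible it
    forbids a nonreal root of $det (B - zA)$ ([ASDC_real_pencil]).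

    Sufficiency.  It is enough to perturb $B$ alone, that is, to show that $B$
    lies in the closure of the set of all $X$ such that [A, X] is SDC
    ([real_pencil_SDC_closure]), by strong induction on the size.  Working with a
    closure lets perturbations be composed: any of the steps below may assume
    that an earlier one has already been carried out exactly.  Take a real
    eigenvalue and replace $B$ by $B - aA$, so that $vB = 0$ for some $v <> 0$.
    - If $v$ is not isotropic for $A$, its $A$-orthogonal complement splits off
      and the induction hypothesis applies there ([SDC_closure_nonisotropic]).
    - If $v$ is isotropic, complete it to a hyperbolic plane of $A$.  In an
      adapted basis $A$ is [hyperbolic A0]; the complement of the plane carries a
      pair [A0, B0] with real roots, coupled to the plane in $B$ by a row $c$.
      By induction $B0$ may be replaced by an $X$ which is SDC with $A0$, then
      shifted by a small multiple of $A0$ so as to be invertible.  Once $X$ is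
      invertible, the root $0$ of the plane is not a root of $[A0, X]$, and the
      coupling can be removed by a congruence preserving $A$
      ([SDC_closure_hyperbolic_SDC]).  There remains a nilpotent 2 by 2 block,
      for which an explicit perturbation works ([SDC_hyperbolic]). *)

(** * Limits and closures in matrix spaces *)

Lemma mx_cvg (R : realType) (T : Type) (F : set_system T) {FF : Filter F} m n
    (f : T -> 'M[R]_(m, n)) (M : 'M[R]_(m, n)) :
  (forall i j, f x i j @[x --> F] --> M i j) -> f @ F --> M.
Proof.
move=> fM; apply/cvg_ballP => e e0.
have : \forall x \near F, forall i j, ball (M i j) e (f x i j).
  apply: filter_forall => i; apply: filter_forall => j.
  exact: (cvg_ball (fM i j) e0).
by apply: filterS => x Mf; split.
Qed.

Lemma continuous_mulmxlr (R : realType) m n p q (C : 'M[R]_(m, n)) (L : 'M[R]_(m, p))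
    (Q : 'M[R]_(q, n)) : continuous (fun X : 'M[R]_(p, q) => C + L *m X *m Q).
Proof.
move=> X; apply: (@mx_cvg _ _ (nbhs X)) => i j.
under eq_fun do rewrite mxE mxE; rewrite mxE mxE.
apply: cvgD; first exact: cvg_cst.
apply: cvg_big => [|k _]; first exact: add_continuous.
apply: cvgM; last exact: cvg_cst.
under eq_fun do rewrite mxE; rewrite mxE.
apply: cvg_big => [|l _]; first exact: add_continuous.
apply: cvgM; first exact: cvg_cst.
exact: coord_continuous.
Qed.

Lemma continuous_line (R : realType) m n (C D : 'M[R]_(m, n)) :
  continuous (fun t : R => C + t *: D).
Proof.
move=> t; apply: (@mx_cvg _ _ (nbhs t)) => i j.
under eq_fun do rewrite mxE mxE; rewrite mxE mxE.
by apply: cvgD; [exact: cvg_cst | apply: cvgM; [exact: cvg_id | exact: cvg_cst]].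
Qed.

(** Asking [f] to map [A] into the closure of [B] only, instead of [B] itself, is
    what allows successive approximations to be chained. *)
Lemma closure_image (T U : topologicalType) (f : T -> U) (A : set T) (B : set U) (x : T) :
  {for x, continuous f} -> (forall y, A y -> closure B (f y)) ->
  closure A x -> closure B (f x).
Proof.
move=> fx AB Ax; rewrite (iffLR (closure_id _) (@closed_closure _ B)) => V fxV.
have [y [Ay Vfy]] := Ax _ (fx _ fxV).
by exists (f y); split; first exact: AB.
Qed.

Lemma closure_line (R : realType) m n (S : set 'M[R]_(m, n)) C D :
  (forall e : R, 0 < e -> exists2 t, `|t| < e & closure S (C + t *: D)) -> closure S C.
Proof.
move=> SCD; have CD0 : C + 0 *: D = C by rewrite scale0r addr0.
rewrite -CD0; apply: (@closure_image R _ (fun t => C + t *: D) [set t | closure S (C + t *: D)]).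
- exact: continuous_line.
- by [].
- move=> V /nbhs_ballP[e /= e0 Ve]; have [t te St] := SCD e e0.
  by exists t; split=> //; apply: Ve; rewrite /ball/= sub0r normrN.
Qed.

Lemma closure_seq (R : realType) m n (S : set 'M[R]_(m, n)) M :
  closure S M -> exists2 u : nat -> 'M[R]_(m, n), forall i, S (u i) & u i @[i --> \oo] --> M.
Proof.
move=> SM.
have /choice[u uP] : forall k : nat, exists X, S X /\ ball M k.+1%:R^-1 X.
  move=> k; apply: SM; apply: nbhsx_ballx; by rewrite invr_gt0 ltr0n.
exists u => [i|]; first by have [] := uP i.
apply/cvg_ballP => e e0; near=> k; have [_] := uP k; apply: le_ball; apply: ltW.
near: k. exact: (near_infty_natSinv_lt (PosNum e0)).
Unshelve. all: by end_near. Qed.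

Lemma cvg_det (K : numFieldType) (T : Type) (F : set_system T) {FF : Filter F} n
    (U : T -> 'M[K]_n) (L : 'M[K]_n) :
  (forall j k, U x j k @[x --> F] --> L j k) -> \det (U x) @[x --> F] --> \det L.
Proof.
move=> UL; apply: cvg_big => [|s _]; first exact: add_continuous.
apply: cvgM; first exact: cvg_cst.
by apply: cvg_big => [|j _]; [exact: mul_continuous | exact: UL].
Qed.

(** * Matrix algebra: congruence and blocks *)

Lemma symmetricmxE (R : realType) n (A : 'M[R]_n) : (A \is symmetricmx) = (A^T == A).
Proof.
by rewrite is_hermitianmxE expr0 scale1r map_mx_id // eq_sym.
Qed.

Lemma unitmx_kerP (K : fieldType) n (A : 'M[K]_n) :
  reflect (forall v : 'rV_n, v *m A = 0 -> v = 0) (A \in unitmx).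
Proof.
rewrite unitmxE unitfE; apply: (iffP negP) => [A0 v vA|A0 /det0P[v v0 vA]].
  by apply/eqP/negP => /negP v0; apply: A0; apply/det0P; exists v.
by move: v0; rewrite (A0 v vA) eqxx.
Qed.

(** Every nonzero vector is the first vector of some basis. *)
Lemma unitmx_first_row (K : fieldType) n (v : 'rV[K]_(1 + n)) : v != 0 ->
  exists2 Q : 'M[K]_(1 + n), Q \in unitmx & row_mx 1%:M 0 *m Q = v.
Proof.
move=> v0; pose e : 'rV[K]_(1 + n) := row_mx 1%:M 0.
have e0 : e != 0 by rewrite row_mx_eq0 negb_and oner_eq0.
have ev : e *m col_mx v 0 = v by rewrite mul_row_col mul1mx mul0mx addr0.
have [|Q Qu QE] := @complete_unitmx _ _ _ e (col_mx v 0); last by exists Q; rewrite // -QE.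
by rewrite ev !rank_rV v0 e0.
Qed.

(** $X + tA$ is singular only if $t$ is an eigenvalue of $-XA^{-1}$, and there are
    at most [n] of those. *)
Lemma unitmx_small_shift (R : realFieldType) n (A X : 'M[R]_n) (e : R) : A \in unitmx -> 0 < e ->
  exists2 t, `|t| < e & X + t *: A \in unitmx.
Proof.
move=> Au e0; apply: contrapT => noT.
pose p := char_poly (- (X *m invmx A)).
(* These [n.+1] distinct points of ]0, e[ exceed the degree of [p]. *)
pose rs := [seq e / k.+2%:R | k <- iota 0 n.+1].
have p0 : p != 0 by rewrite monic_neq0 // char_poly_monic.
suff : (size rs < size p)%N by rewrite size_char_poly size_map size_iota ltnn.
apply: max_poly_roots => //.
  apply/allP => _ /mapP[k _ ->]; rewrite -eigenvalue_root_char.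
  have : e / k.+2%:R < e by rewrite gtr_pMr // invf_lt1 ?ltr1n.
  set t := e / _ => te; have t0 : 0 < t by rewrite divr_gt0.
  have : ~ X + t *: A \in unitmx.
    by move=> Xtu; apply: noT; exists t; rewrite // gtr0_norm.
  move=> /negP; rewrite unitmxE unitfE negbK => /det0P[v v0 /eqP].
  rewrite mulmxDr addr_eq0 -scalemxAr => /eqP vX.
  apply/eigenvalueP; exists v => //.
  by rewrite mulmxN mulmxA vX mulNmx opprK -scalemxAl mulmxK.
rewrite map_inj_uniq ?iota_uniq // => k l /(mulfI (lt0r_neq0 e0)) /invr_inj.
by move=> /eqP; rewrite eqr_nat => /eqP[].
Qed.

(** Vectors are rows throughout: the rows of [Q] are the new basis vectors, and
    [congr_mx Q A] is the Gram matrix of the form [A] in that basis. *)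
Definition congr_mx (R : pzRingType) n (Q A : 'M[R]_n) : 'M[R]_n := Q *m A *m Q^T.

Lemma congr_mxM (R : comPzRingType) n (P Q A : 'M[R]_n) :
  congr_mx (P *m Q) A = congr_mx P (congr_mx Q A).
Proof. by rewrite /congr_mx trmx_mul !mulmxA. Qed.

Lemma congr_mx1 (R : comPzRingType) n (A : 'M[R]_n) : congr_mx 1%:M A = A.
Proof. by rewrite /congr_mx trmx1 mulmx1 mul1mx. Qed.

Lemma congr_mx_sym (R : comPzRingType) n (Q A : 'M[R]_n) :
  A^T = A -> (congr_mx Q A)^T = congr_mx Q A.
Proof. by move=> As; rewrite /congr_mx !trmx_mul trmxK As mulmxA. Qed.

Lemma congr_mx_unit (R : comUnitRingType) n (Q A : 'M[R]_n) : Q \in unitmx ->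
  (congr_mx Q A \in unitmx) = (A \in unitmx).
Proof. by move=> Qu; rewrite /congr_mx !unitmx_mul unitmx_tr Qu andbT. Qed.

Lemma congr_mx_diag (R : comPzRingType) m n (P A : 'M[R]_m) (Q B : 'M[R]_n) :
  congr_mx (block_mx P 0 0 Q) (block_mx A 0 0 B) = block_mx (congr_mx P A) 0 0 (congr_mx Q B).
Proof.
rewrite /congr_mx tr_block_mx !mulmx_block !trmx0.
by rewrite !(mul0mx, mulmx0, addr0, add0r).
Qed.

Lemma unitmx_diag (R : comUnitRingType) m n (P : 'M[R]_m) (Q : 'M[R]_n) :
  (block_mx P 0 0 Q \in unitmx) = (P \in unitmx) && (Q \in unitmx).
Proof. by rewrite !unitmxE det_ublock unitrM. Qed.

(** Adding multiples of the first basis vectors to the others; for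
    $c = - s a^{-1}$ this eliminates [s]. *)
Lemma congr_mx_ltri (R : comPzRingType) m n (c : 'M[R]_(n, m)) a r s A :
  congr_mx (block_mx 1%:M 0 c 1%:M) (block_mx a r s A) =
  block_mx a (a *m c^T + r) (c *m a + s) ((c *m a + s) *m c^T + (c *m r + A)).
Proof.
rewrite /congr_mx tr_block_mx !mulmx_block !trmx0 !trmx1.
by rewrite !(mul0mx, mulmx0, mul1mx, mulmx1, addr0).
Qed.

Lemma unitmx_ltri (R : comUnitRingType) m n (c : 'M[R]_(n, m)) :
  block_mx 1%:M 0 c 1%:M \in unitmx.
Proof. by rewrite unitmxE det_lblock !det1 mulr1 unitr1. Qed.

Lemma row_mx_neq0 (V : nmodType) m n1 n2 (A : 'M[V]_(m, n1)) (B : 'M[V]_(m, n2)) :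
  B != 0 -> row_mx A B != 0.
Proof. by apply: contra_neq => /eqP; rewrite row_mx_eq0 => /andP[_ /eqP]. Qed.

(** The form in which [SDC_closure_affine] sees an embedding of a smaller
    matrix space. *)
Lemma block_diag_affine (R : pzRingType) m n (X : 'M[R]_n) (Y : 'M[R]_m) :
  block_mx Y 0 0 X = block_mx Y 0 0 0 + col_mx 0 1%:M *m X *m row_mx 0 1%:M.
Proof.
rewrite mul_col_mx mul_col_row !mul0mx !mulmx0 mul1mx mulmx1.
by rewrite add_block_mx !addr0 add0r.
Qed.

(** Evaluates products of nested block matrices.  Outer block shapes have to be
    matched before [mul_mx_row] and [mul_col_mx], which would otherwise break a
    column times row product into a row of columns. *)
Definition block_mxE := (mulmx_block, mul_row_block, mul_block_col,
  mul_row_col, mul_col_row, mul_mx_row, mul_col_mx,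
  (add_block_mx, add_row_mx, add_col_mx, scale_row_mx, scale_col_mx, scaler0),
  (row_mx0, col_mx0, mulmx0, mul0mx, addr0, add0r, mulmx1, mul1mx),
  (mul_scalar_mx, scale_scalar_mx, mulr0, mulr1)).

Lemma sym_blockE (V : nmodType) n (A : 'M[V]_(1 + n)) : A^T = A ->
  (drsubmx A)^T = drsubmx A /\
  A = block_mx (ulsubmx A) (ursubmx A) (ursubmx A)^T (drsubmx A).
Proof.
by move=> As; rewrite trmx_drsub trmx_ursub As submxK.
Qed.

Lemma sym_degenerateE (K : fieldType) n (B : 'M[K]_(1 + n)) : B^T = B ->
  row_mx 1%:M 0 *m B = 0 -> B = block_mx 0 0 0 (drsubmx B).
Proof.
move=> /sym_blockE[_ BE]; rewrite {1}BE mul_row_block !mul1mx !mul0mx !addr0.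
by move=> /eqP; rewrite row_mx_eq0 => /andP[/eqP ul /eqP ur]; rewrite {1}BE ul ur trmx0.
Qed.

(** * SDC pairs and real pencils *)

(** The transposed, row vector version of the definition. *)
Lemma SDC_pairP (R : realType) n (A B : 'M[R]_n) :
  SDC [set A; B] <-> exists2 Q : 'M[R]_n, Q \in unitmx &
    is_diag_mx (Q *m A *m Q^T) && is_diag_mx (Q *m B *m Q^T).
Proof.
split=> [[P Pu PAB]|[Q Qu /andP[QA QB]]].
  exists P^T; first by rewrite unitmx_tr.
  by rewrite trmxK !PAB //=; [right | left].
by exists Q^T; rewrite ?unitmx_tr // trmxK => C [] ->.
Qed.

Lemma SDC_sym (R : realType) n (A B : 'M[R]_n) : SDC [set A; B] -> B^T = B.
Proof.
move=> /SDC_pairP[Q Qu /andP[_ /diag_mxP[b QB]]].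
have QTu : Q^T \in unitmx by rewrite unitmx_tr.
apply: (can_inj (mulmxK QTu)); apply: (can_inj (mulKmx Qu)); rewrite !mulmxA.
have -> : Q *m B^T *m Q^T = (Q *m B *m Q^T)^T by rewrite !trmx_mul trmxK mulmxA.
by rewrite QB tr_diag_mx.
Qed.

(** The roots of the pencil $zA - B$ are real.  Eigenvectors are quantified over
    directly, so that passing to a diagonal block amounts to extending a vector,
    without computing determinants. *)
Definition real_pencil (R : realType) n (A B : 'M[R]_n) : Prop :=
  forall (z : R[i]) (y : 'rV_n), y != 0 ->
    y *m toC B = z *: (y *m toC A) -> z \is Num.real.

Lemma real_pencilP (R : realType) n (A B : 'M[R]_n) : A \in unitmx ->
  has_real_eigenvalues (invmx A *m B) <-> real_pencil A B.
Proof.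
move=> Au; have AuC : toC A \in unitmx by rewrite map_unitmx.
split=> [AB z y y0 yAB|AB z /eigenvalueP[v vAB v0]].
  apply: AB; apply/eigenvalueP; exists (y *m toC A).
    by rewrite map_mxM map_invmx mulmxA mulmxK.
  by apply: contra_neq y0 => yA; rewrite -(mulmxK AuC y) yA mul0mx.
apply: (AB z (v *m toC (invmx A))).
  apply: contra_neq v0 => vA; have : v *m toC (invmx A) *m toC A = 0.
    by rewrite vA mul0mx.
  by rewrite map_invmx mulmxKV.
by rewrite map_invmx mulmxKV // -vAB map_mxM map_invmx mulmxA.
Qed.

(** * Limits of SDC pairs have real eigenvalues *)

Lemma normcE (R : realType) (z : R[i]) : `|z| = (normc z)%:C%C.
Proof. by rewrite normc_def; case: z. Qed.

Lemma normc_real (R : realType) (x : R) : normc x%:C%C = `|x|.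
Proof. by rewrite /= expr0n addr0 sqrtr_sqr. Qed.

Lemma continuous_real_complex (R : realType) : continuous (real_complex R : R -> Cfield R).
Proof.
move=> x; apply/cvgrPdist_lt => e; rewrite ltcE => /andP[/eqP/= e_real e0].
have eE : e = (complex.Re e)%:C%C by case: e e_real {e0} => a b /= ->.
near=> y; rewrite -rmorphB normcE eE normc_real ltcR.
by near: y; apply: (@cvgr_dist_lt _ R _ (nbhs x) _ id x); [exact: cvg_id | exact: e0].
Unshelve. all: by end_near. Qed.

Lemma normc_cvg (R : realType) (T : Type) (F : set_system T) {FF : Filter F} (u : T -> Cfield R) :
  u @ F --> (0 : Cfield R) -> normc (u x) @[x --> F] --> (0 : R).
Proof.
move=> u0; apply/cvgr0Pnorm_lt => e e0; near=> x.
rewrite ger0_norm; last by rewrite -ler0c -normcE.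
rewrite -ltcR -normcE; near: x.
by apply: (cvgr0_norm_lt u u0); rewrite ltcR.
Unshelve. all: by end_near. Qed.

Lemma normc_Im_le (R : realType) (a b : R) (z : R[i]) :
  `|complex.Im z| * `|a| <= normc (b%:C%C - z * a%:C%C).
Proof.
case: z => x y; rewrite -normrM -sqrtr_sqr /=; apply: ler_wsqrtr.
by rewrite !mulr0 !subr0 !add0r sqrrN lerDr sqr_ge0.
Qed.

(** The quantitative reason why SDC pairs have real roots, in a form that is
    stable under limits: no inverse of [A] occurs. *)
Lemma SDC_det_lower_bound (R : realType) n (A B : 'M[R]_n) (z : R[i]) :
  SDC [set A; B] ->
  `|complex.Im z| ^+ n * `|\det A| <= normc (\det (toC B - z *: toC A)).
Proof.
move=> /SDC_pairP[Q Qu /andP[/diag_mxP[a QA] /diag_mxP[b QB]]].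
have detQ0 : 0 < `|\det Q * \det Q|.
  by rewrite normr_gt0 mulf_neq0 // -unitfE -unitmxE.
rewrite -(ler_pM2l detQ0).
have -> : `|\det Q * \det Q| * (`|complex.Im z| ^+ n * `|\det A|) =
    `|complex.Im z| ^+ n * `|\det (Q *m A *m Q^T)|.
  by rewrite !det_mulmx det_tr !normrM; ring.
have -> : `|\det Q * \det Q| * normc (\det (toC B - z *: toC A)) =
    normc (\det (toC (Q *m B *m Q^T) - z *: toC (Q *m A *m Q^T))).
  have -> : toC (Q *m B *m Q^T) - z *: toC (Q *m A *m Q^T) =
      toC Q *m (toC B - z *: toC A) *m (toC Q)^T.
    by rewrite !map_mxM map_trmx mulmxBr mulmxBl -scalemxAr -scalemxAl.
  rewrite !det_mulmx det_tr det_map_mx !normcM.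
  by rewrite normc_real normrM; ring.
rewrite QA QB.
have -> : toC (diag_mx b) - z *: toC (diag_mx a) =
    diag_mx (toC b - z *: toC a).
  by rewrite !map_diag_mx -linearZ -linearB.
rewrite !det_diag (big_morph _ (@normcM R) (@normc1 R)).
rewrite normr_prod -[n in _ ^+ n]card_ord -prodr_const -big_split /=.
apply: ler_prod => i _; rewrite mulr_ge0 //= !mxE; exact: normc_Im_le.
Qed.

Lemma ASDC_real_pencil (R : realType) n (A B : 'M[R]_n) :
  A \in unitmx -> ASDC [set A; B] -> real_pencil A B.
Proof.
move=> Au [u [_ ucvg uSDC]] z y y0 yAB.
have bound i : `|complex.Im z| ^+ n * `|\det (u A i)| <=
    normc (\det (toC (u B i) - z *: toC (u A i))).
  by apply: SDC_det_lower_bound; have := uSDC i; rewrite image_setU !image_set1.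
have entry X (j k : 'I_n) : [set A; B] X -> u X i j k @[i --> \oo] --> X j k.
  move=> SX; apply: (cvg_comp _ _ (ucvg X SX) (@coord_continuous _ _ _ j k X)).
have det0 : \det (toC B - z *: toC A) = 0.
  by apply/eqP/det0P; exists y; rewrite // mulmxBr yAB -scalemxAr subrr.
have detA : \det (u A i) @[i --> \oo] --> \det A.
  by apply: cvg_det => j k; apply: entry; left.
have detAB : (\det (toC (u B i) - z *: toC (u A i)) : Cfield R) @[i --> \oo] --> (0 : Cfield R).
  rewrite -det0; apply: cvg_det => j k; under eq_fun do rewrite !mxE; rewrite !mxE.
  have entryC X : [set A; B] X ->
      ((u X i j k)%:C%C : Cfield R) @[i --> \oo] --> ((X j k)%:C%C : Cfield R).
    by move=> SX; apply: (cvg_comp _ _ (entry X j k SX) (@continuous_real_complex R _)).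
  apply: cvgB; first by apply: entryC; right.
  by apply: cvgM; [exact: cvg_cst | apply: entryC; left].
have lim_bound : `|complex.Im z| ^+ n * `|\det A| <= 0.
  apply: (ler_cvg_to _ (normc_cvg detAB) (nearW _ bound)).
  by apply: cvgM; [exact: cvg_cst | exact: cvg_norm].
have : `|complex.Im z| ^+ n * `|\det A| == 0 by rewrite eq_le lim_bound mulr_ge0 ?exprn_ge0.
rewrite mulf_eq0 expf_eq0 !normr_eq0.
have -> : (\det A == 0) = false.
  by move: Au; rewrite unitmxE unitfE => /negbTE.
by case: z {bound yAB det0 detAB lim_bound} => a b; rewrite orbF complex_real => /andP[].
Qed.

(** * The closure of the matrices that are SDC with a given one *)

Definition SDC_closure (R : realType) n (A : 'M[R]_n) : set 'M[R]_n :=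
  closure [set X | SDC [set A; X]].

(** An approximation of a smaller pair is transported along an affine embedding,
    provided that exact SDC pairs are sent to approximable ones. *)
Lemma SDC_closure_affine (R : realType) p n (A : 'M[R]_p) (A' C : 'M[R]_n)
    (L : 'M[R]_(n, p)) (Q : 'M[R]_(p, n)) :
  (forall X, SDC [set A; X] -> SDC_closure A' (C + L *m X *m Q)) ->
  forall X, SDC_closure A X -> SDC_closure A' (C + L *m X *m Q).
Proof.
move=> AA' X AX.
apply: (@closure_image _ _ (fun X => C + L *m X *m Q) _ _ X _ _ AX) => //.
exact: continuous_mulmxlr.
Qed.

Section Congruence.
Variables (R : realType) (n : nat).
Implicit Types A B Q X : 'M[R]_n.

Lemma SDC_congr Q A B : Q \in unitmx ->
  SDC [set congr_mx Q A; congr_mx Q B] -> SDC [set A; B].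
Proof.
move=> Qu /SDC_pairP[P Pu]; rewrite -!/(congr_mx _ _) -!congr_mxM => PQ.
by apply/SDC_pairP; exists (P *m Q) => //; rewrite unitmx_mul Pu.
Qed.

Lemma SDC_closure_congr Q A B : Q \in unitmx ->
  SDC_closure (congr_mx Q A) (congr_mx Q B) -> SDC_closure A B.
Proof.
move=> Qu QAB; have Qi : invmx Q \in unitmx by rewrite unitmx_inv.
have -> : B = 0 + invmx Q *m congr_mx Q B *m (invmx Q)^T.
  by rewrite add0r -/(congr_mx _ _) -congr_mxM mulVmx // congr_mx1.
apply: SDC_closure_affine QAB => X SX; apply: subset_closure; apply: (SDC_congr Qu) => /=.
by rewrite add0r -/(congr_mx _ _) -congr_mxM mulmxV // congr_mx1.
Qed.

Lemma real_pencil_congr Q A B : Q \in unitmx ->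
  real_pencil A B -> real_pencil (congr_mx Q A) (congr_mx Q B).
Proof.
move=> Qu AB z y y0 yE; have QuC : toC Q \in unitmx by rewrite map_unitmx.
apply: (AB z (y *m toC Q)).
  by apply: contra_neq y0 => yQ; rewrite -(mulmxK QuC y) yQ mul0mx.
have QTu : (toC Q)^T \in unitmx by rewrite unitmx_tr.
apply: (can_inj (mulmxK QTu)).
by move: yE; rewrite /congr_mx !map_mxM -!map_trmx !mulmxA -scalemxAl.
Qed.

Lemma SDC_shift A B (a : R) : SDC [set A; B] -> SDC [set A; B + a *: A].
Proof.
move=> /SDC_pairP[Q Qu /andP[QA QB]]; apply/SDC_pairP; exists Q => //.
rewrite QA mulmxDr mulmxDl -scalemxAr -scalemxAl.
have [a' ->] := diag_mxP _ QA; have [b ->] := diag_mxP _ QB.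
by rewrite -linearZ -linearD diag_mx_is_diag.
Qed.

Lemma SDC_closure_shift A B (a : R) : SDC_closure A (B + a *: A) -> SDC_closure A B.
Proof.
move=> AB; have -> : B = - a *: A + 1%:M *m (B + a *: A) *m 1%:M.
  by rewrite mul1mx mulmx1 addrC scaleNr addrK.
apply: SDC_closure_affine AB => X SX; apply: subset_closure => /=.
by rewrite mul1mx mulmx1 addrC; exact: SDC_shift.
Qed.

Lemma real_pencil_shift A B (a : R) : real_pencil A B -> real_pencil A (B + a *: A).
Proof.
move=> AB z y y0 yE; rewrite -[z](subrK a%:C%C).
rewrite rpredD //; last by apply/complex_realP; exists a.
apply: (AB _ y y0); move: yE; rewrite map_mxD map_mxZ mulmxDr -scalemxAr scalerBl => <-.
by rewrite addrK.
Qed.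

Lemma real_pencil_eigen A B : (0 < n)%N -> A \in unitmx -> real_pencil A B ->
  exists (a : R) (v : 'rV_n), v != 0 /\ v *m B = a *: (v *m A).
Proof.
move=> n0 Au AB.
have [z zE] := @eigenvalue_closed (R[i] : numClosedFieldType) n (toC (invmx A *m B)) n0.
have /(_ z zE)/complex_realP[a za] := iffRL (real_pencilP _ Au) AB.
move: zE; rewrite za eigenvalue_map => /eigenvalueP[v vE v0].
exists a, (v *m invmx A); split; last by rewrite mulmxKV // -mulmxA vE.
by apply: contra_neq v0 => vA; rewrite -(mulmxKV Au v) vA mul0mx.
Qed.
End Congruence.

(** * Splitting off a nonisotropic vector *)

Section SplitLine.
Variables (R : realType) (n : nat).

Lemma SDC_diag m (A B : 'M[R]_m) (A' B' : 'M[R]_n) :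
  SDC [set A; B] -> SDC [set A'; B'] ->
  SDC [set block_mx A 0 0 A'; block_mx B 0 0 B'].
Proof.
move=> /SDC_pairP[P Pu /andP[PA PB]] /SDC_pairP[Q Qu /andP[QA QB]].
apply/SDC_pairP; exists (block_mx P 0 0 Q); first by rewrite unitmx_diag Pu.
rewrite -!/(congr_mx _ _) !congr_mx_diag !is_diag_block_mx // !eqxx /=.
by rewrite PA PB QA QB.
Qed.

Lemma SDC_mx1 (a b : 'M[R]_1) : SDC [set a; b].
Proof. by apply/SDC_pairP; exists 1%:M; rewrite ?unitmx1 // !mx11_is_diag. Qed.

Lemma SDC_closure_diag1 (a b : 'M[R]_1) (A B : 'M[R]_n) : SDC_closure A B ->
  SDC_closure (block_mx a 0 0 A) (block_mx b 0 0 B).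
Proof.
move=> AB; rewrite [X in SDC_closure _ X]block_diag_affine.
apply: SDC_closure_affine AB => X SX.
rewrite -block_diag_affine; apply: subset_closure; apply: SDC_diag => //.
exact: SDC_mx1.
Qed.

(** The conclusion of the induction, for a given form [A]. *)
Definition approximable (A : 'M[R]_n) := forall B, B^T = B -> real_pencil A B -> SDC_closure A B.

Lemma real_pencil_diag m (A B : 'M[R]_m) (A' B' : 'M[R]_n) :
  real_pencil (block_mx A 0 0 A') (block_mx B 0 0 B') -> real_pencil A' B'.
Proof.
move=> AB z y y0 yE; apply: (AB z (row_mx 0 y)); first exact: row_mx_neq0.
rewrite !map_block_mx !map_mx0 !mul_row_block !mul0mx !mulmx0 !add0r yE.
by rewrite scale_row_mx scaler0.
Qed.

(** Since $a <> 0$, the rest of the space can be made orthogonal to the first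
    basis vector.  As that vector is in the kernel of the second form, doing so
    leaves the second form unchanged. *)
Lemma SDC_closure_nonisotropic (a : R) (r : 'M[R]_(1, n)) (A B : 'M[R]_n) : a != 0 ->
  (forall A' : 'M[R]_n, A'^T = A' -> A' \in unitmx -> approximable A') ->
  A^T = A -> B^T = B ->
  block_mx a%:M r r^T A \in unitmx ->
  real_pencil (block_mx a%:M r r^T A) (block_mx 0 0 0 B) ->
  SDC_closure (block_mx a%:M r r^T A) (block_mx 0 0 0 B).
Proof.
move=> a0 IH As Bs Au AB.
pose Q := block_mx 1%:M 0 (- a^-1 *: r^T) 1%:M : 'M[R]_(1 + n).
have Qu : Q \in unitmx by exact: unitmx_ltri.
pose A' := A + - a^-1 *: r^T *m r.
have QA : congr_mx Q (block_mx a%:M r r^T A) = block_mx a%:M 0 0 A'.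
  rewrite congr_mx_ltri linearZ /= trmxK mul_scalar_mx mul_mx_scalar !scalerA.
  rewrite mulrN mulfV // !scaleN1r !addNr mul0mx add0r.
  by rewrite [_ *m r + A]addrC.
have QB : congr_mx Q (block_mx 0 0 0 B) = block_mx 0 0 0 B.
  by rewrite congr_mx_ltri !(mul0mx, mulmx0, add0r).
apply: (SDC_closure_congr Qu); rewrite QA QB; apply: SDC_closure_diag1.
apply: IH => //.
- by rewrite /A' linearD /= As -scalemxAl linearZ /= trmx_mul trmxK.
- by move: Au; rewrite -(congr_mx_unit _ Qu) QA unitmx_diag => /andP[].
- by have := real_pencil_congr Qu AB; rewrite QA QB; exact: real_pencil_diag.
Qed.

End SplitLine.

(** * Splitting off a hyperbolic plane *)

Section Hyperbolic.
Variables (R : realType) (n : nat).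

(** The orthogonal sum of a hyperbolic plane, spanned by two isotropic vectors
    [e1] and [e2] with product 1, and of the form [A]. *)
Definition hyperbolic (A : 'M[R]_n) : 'M[R]_(1 + (1 + n)) :=
  block_mx 0 (row_mx 1%:M 0) (col_mx 1%:M 0) (block_mx 0 0 0 A).

(** On the plane, the forms $2xy$ and $bs x^2 + b y^2$ are diagonalized by the
    basis $(r, 1), (r, -1)$ with $r^2 s = 1$: these vectors are orthogonal for
    the first form whatever [r] is, and for the second because
    $bs r^2 = b$.  Positivity of [s] is exactly what makes [r] real. *)
Lemma SDC_hyperbolic (b s : R) (A B : 'M[R]_n) : 0 < s ->
  SDC [set A; B] ->
  SDC [set hyperbolic A; block_mx (b * s)%:M 0 0 (block_mx b%:M 0 0 B)].
Proof.
move=> s0 /SDC_pairP[Q Qu /andP[QA QB]].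
pose r := Num.sqrt s^-1.
have r0 : r != 0 by rewrite gt_eqF // sqrtr_gt0 invr_gt0.
have rs : r * s * r = 1.
  by rewrite mulrAC -expr2 sqr_sqrtr ?invr_ge0 ?ltW // mulVf // gt_eqF.
pose P : 'M[R]_(1 + (1 + n)) :=
  block_mx r%:M (row_mx 1%:M 0) (col_mx r%:M 0) (block_mx (-1)%:M 0 0 Q).
apply/SDC_pairP; exists P.
  apply/unitmx_kerP => v.
  rewrite -[v]hsubmxK -[rsubmx v]hsubmxK.
  move: (lsubmx v) (lsubmx (rsubmx v)) (rsubmx (rsubmx v)) => v1 v2 v3 {v}.
  rewrite mul_row_block mul_row_col mul_mx_row mul_row_block.
  rewrite !(mulmx0, mulmx1, addr0, add0r, mul_mx_scalar, scaleN1r, scale1r).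
  rewrite add_row_mx !(add0r, addr0).
  move=> /eqP; rewrite row_mx_eq0 row_mx_eq0.
  rewrite -scalerDr scaler_eq0 (negbTE r0) /= subr_eq0.
  move=> /and3P[/eqP v12 /eqP v1E /eqP vQ].
  have -> : v3 = 0 by rewrite -(mulmxK Qu v3) vQ mul0mx.
  have v20 : v2 = 0.
    by apply/eqP; move/eqP: v12; rewrite v1E -mulr2n -scaler_nat scaler_eq0 pnatr_eq0.
  by rewrite v1E v20 !row_mx0.
have PT : P^T = block_mx r%:M (row_mx r%:M 0) (col_mx 1%:M 0) (block_mx (-1)%:M 0 0 Q^T).
  by rewrite !tr_block_mx tr_row_mx tr_col_mx !tr_scalar_mx !trmx0.
apply/andP; split.
  have -> : P *m hyperbolic A *m P^T =
      block_mx (r + r)%:M 0 0 (block_mx (- r - r)%:M 0 0 (Q *m A *m Q^T)).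
    rewrite PT /P /hyperbolic !block_mxE mulrN1 mulN1r.
    rewrite -!(raddfD (@scalar_mx R 1)) subrr addNr (raddf0 (@scalar_mx R 1)).
    by rewrite row_mx0 col_mx0.
  by rewrite !is_diag_block_mx // !eqxx !mx11_is_diag QA.
have -> : P *m block_mx (b * s)%:M 0 0 (block_mx b%:M 0 0 B) *m P^T =
    block_mx (b + b)%:M 0 0 (block_mx (b + b)%:M 0 0 (Q *m B *m Q^T)).
  rewrite PT /P !block_mxE.
  have -> : r * (b * s) * r = b by rewrite -[RHS]mulr1 -rs; ring.
  rewrite !mulN1r !mulrN1 opprK -!(raddfD (@scalar_mx R 1)) subrr.
  by rewrite (raddf0 (@scalar_mx R 1)) row_mx0 col_mx0 -block_mxEv.
by rewrite !is_diag_block_mx // !eqxx !mx11_is_diag QB.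
Qed.

(** For $b <> 0$ the zero diagonal entry is replaced by a small number of the
    same sign as [b]; the case $b = 0$ is a limit of the previous one. *)
Lemma SDC_closure_decoupled (b : R) (A X : 'M[R]_n) : SDC [set A; X] ->
  SDC_closure (hyperbolic A) (block_mx 0 0 0 (block_mx b%:M 0 0 X)).
Proof.
move=> AX.
have nonzero c : c != 0 ->
    SDC_closure (hyperbolic A) (block_mx 0 0 0 (block_mx c%:M 0 0 X)).
  move=> c0; apply: (@closure_line _ _ _ _ _ (block_mx 1%:M 0 0 0)) => e e0.
  pose s := e / 2 / `|c|; have s0 : 0 < s by rewrite !divr_gt0 ?normr_gt0.
  exists (c * s).
    rewrite normrM (gtr0_norm s0) /s mulrC divfK ?normr_eq0 //.
    by rewrite gtr_pMr // invf_lt1 ?ltr1n.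
  rewrite scale_block_mx add_block_mx !scaler0 !addr0 add0r scale_scalar_mx mulr1.
  exact/subset_closure/SDC_hyperbolic.
have [->|/nonzero//] := eqVneq b 0.
apply: (@closure_line _ _ _ _ _ (block_mx 0 0 0 (block_mx 1%:M 0 0 0))) => e e0.
exists (e / 2); first by rewrite gtr0_norm ?divr_gt0 // gtr_pMr // invf_lt1 ?ltr1n.
rewrite !scale_block_mx !add_block_mx !scaler0 !addr0 !scale_scalar_mx mulr1.
rewrite (raddf0 (@scalar_mx R 1)) !add0r; apply: nonzero.
by rewrite gt_eqF // divr_gt0.
Qed.

(** Since [e1] has product 1 with [e2] and 0 with the remaining vectors, adding
    multiples of [e1] makes [e2] isotropic and orthogonal to them.  Forms with
    [e1] in their kernel are unaffected. *)
Lemma congr_hyperbolic_clear (a : R) (s : 'M[R]_(1, n)) (A : 'M[R]_n) :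
  exists2 Q : 'M[R]_(1 + (1 + n)), Q \in unitmx &
    congr_mx Q (block_mx 0 (row_mx 1%:M 0) (col_mx 1%:M 0) (block_mx a%:M s s^T A)) =
      hyperbolic A /\
    forall B, congr_mx Q (block_mx 0 0 0 B) = block_mx 0 0 0 B.
Proof.
(* The factor 1/2 appears because [e1] occurs twice in the product of
   $e2 + t e1$ with itself, which is $a + 2t$. *)
pose c : 'M[R]_(1 + n, 1) := col_mx (- (a / 2))%:M (- s^T).
exists (block_mx 1%:M 0 c 1%:M); first exact: unitmx_ltri.
split=> [|B]; rewrite congr_mx_ltri; last by rewrite !(mul0mx, mulmx0, add0r).
rewrite /c /hyperbolic tr_col_mx tr_scalar_mx linearN /= trmxK.
rewrite !block_mxE !addNr -!(raddfD (@scalar_mx R 1)).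
have -> : - (a / 2) + (- (a / 2) + a) = 0 by field.
by rewrite (raddf0 (@scalar_mx R 1)).
Qed.

(** When [X] is invertible, $e2 + x$ with $x = -c X^{-1}$ is orthogonal to the
    last summand for the second form.  The form [A] then acquires new products
    among $e2 + x$ and the last summand, but these are cleared using [e1], at no
    cost for the second form. *)
Lemma SDC_closure_hyperbolic_SDC (b : R) (c : 'M[R]_(1, n)) (A X : 'M[R]_n) :
  A^T = A -> A \in unitmx -> SDC [set A; X] ->
  SDC_closure (hyperbolic A) (block_mx 0 0 0 (block_mx b%:M c c^T X)).
Proof.
move=> As Au AX.
apply: (@closure_line _ _ _ _ _ (block_mx 0 0 0 (block_mx 0 0 0 A))) => e e0.
have [t te Xtu] := unitmx_small_shift X Au e0; exists t => //.
rewrite !scale_block_mx !add_block_mx !scaler0 !addr0.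
have {AX} : SDC [set A; X + t *: A] by exact: SDC_shift.
move: (X + t *: A) Xtu => {}X Xu AX.
have Xs := SDC_sym AX.
pose x := - c *m invmx X.
have xX : c + x *m X = 0 by rewrite mulmxKV // addrN.
have Xx : c^T + X *m x^T = 0.
  by rewrite -[in X *m _]Xs -trmx_mul -linearD /= xX trmx0.
pose Q1 : 'M[R]_(1 + n) := block_mx 1%:M x 0 1%:M.
pose Q : 'M[R]_(1 + (1 + n)) := block_mx 1%:M 0 0 Q1.
have Q1u : Q1 \in unitmx by rewrite unitmxE det_ublock !det1 mulr1 unitr1.
have Qu : Q \in unitmx by rewrite unitmx_diag unitmx1.
have QA : congr_mx Q (hyperbolic A) =
    block_mx 0 (row_mx 1%:M 0) (col_mx 1%:M 0)
      (block_mx (x *m A *m x^T) (x *m A) (x *m A)^T A).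
  rewrite /congr_mx /Q /Q1 /hyperbolic !tr_block_mx !trmx0 !trmx1 !block_mxE.
  by rewrite [(x *m A)^T]trmx_mul As.
have QB : congr_mx Q (block_mx 0 0 0 (block_mx b%:M c c^T X)) =
    block_mx 0 0 0 (block_mx (b%:M + x *m c^T) 0 0 X).
  rewrite /congr_mx /Q /Q1 /hyperbolic !tr_block_mx !trmx0 !trmx1 !block_mxE.
  by rewrite xX Xx mul0mx addr0.
apply: (SDC_closure_congr Qu); rewrite QA QB.
rewrite [x *m A *m x^T]mx11_scalar [b%:M + _]mx11_scalar.
have [P Pu [PA PB]] := congr_hyperbolic_clear ((x *m A *m x^T) 0 0) (x *m A) A.
apply: (SDC_closure_congr Pu); rewrite PA PB.
exact: SDC_closure_decoupled.
Qed.

(** The induction step for an isotropic kernel vector. *)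
Lemma SDC_closure_hyperbolic (b : R) (c : 'M[R]_(1, n)) (A B : 'M[R]_n) :
  A^T = A -> A \in unitmx -> approximable A -> B^T = B ->
  real_pencil (hyperbolic A) (block_mx 0 0 0 (block_mx b%:M c c^T B)) ->
  SDC_closure (hyperbolic A) (block_mx 0 0 0 (block_mx b%:M c c^T B)).
Proof.
move=> As Au clA Bs AB.
have affine X : block_mx 0 0 0 (block_mx b%:M c c^T X) =
    block_mx 0 0 0 (block_mx b%:M c c^T 0) +
    col_mx 0 (col_mx 0 1%:M) *m X *m row_mx 0 (row_mx 0 1%:M) :> 'M[R]_(1 + (1 + n)).
  rewrite ![col_mx _ _ *m X]mul_col_mx !mul0mx mul1mx !mul_col_row.
  rewrite !mul0mx !mulmx0 !mulmx1 ?row_mx0 ?col_mx0.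
  by rewrite !add_block_mx !addr0 add0r.
suff AB' : SDC_closure A B.
  rewrite affine; apply: SDC_closure_affine AB' => X AX.
  by rewrite -affine; exact: SDC_closure_hyperbolic_SDC.
apply: clA => // z y y0 yE; have [->|z0] := eqVneq z 0; first exact: rpred0.
(* A root [z] of the smaller pencil, with eigenvector [y], is a root of the
   larger one: the coordinate [w] on [e1] makes up for the coupling [c].  The
   division by [z] is harmless, as 0 is real anyway. *)
pose w := z^-1 *: (y *m toC c^T).
apply: (AB z (row_mx w (row_mx 0 y))).
  by apply: row_mx_neq0; apply: row_mx_neq0.
rewrite /hyperbolic !map_block_mx map_row_mx map_col_mx !map_mx0 map_mx1 !block_mxE.
by rewrite yE /w scalerA mulfV // scale1r.
Qed.
End Hyperbolic.

(** * Induction on the size *)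

Section Main.
Variable R : realType.

(** As [A] is nondegenerate, the isotropic vector [e1] pairs with the others by
    some $r <> 0$; a change of basis of the complement turns [r] into
    $(1, 0, ..., 0)$, which exhibits the hyperbolic plane. *)
Lemma SDC_closure_isotropic n (r : 'rV[R]_(1 + n)) (A B : 'M[R]_(1 + n)) :
  r != 0 -> (forall A' : 'M[R]_n, A'^T = A' -> A' \in unitmx -> approximable A') ->
  A^T = A -> B^T = B -> block_mx 0 r r^T A \in unitmx ->
  real_pencil (block_mx 0 r r^T A) (block_mx 0 0 0 B) ->
  SDC_closure (block_mx 0 r r^T A) (block_mx 0 0 0 B).
Proof.
move=> r0 IH As Bs Au AB.
have [g gu gr] := unitmx_first_row r0.
have rg : r *m invmx g = row_mx 1%:M 0 by rewrite -gr mulmxK.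
have giu : (invmx g)^T \in unitmx by rewrite unitmx_tr unitmx_inv.
pose P : 'M[R]_(1 + (1 + n)) := block_mx 1%:M 0 0 (invmx g)^T.
have Pu : P \in unitmx by rewrite unitmx_diag unitmx1.
pose A1 := congr_mx (invmx g)^T A; pose B1 := congr_mx (invmx g)^T B.
have PA : congr_mx P (block_mx 0 r r^T A) =
    block_mx 0 (row_mx 1%:M 0) (col_mx 1%:M 0) A1.
  rewrite /congr_mx /P tr_block_mx trmxK !trmx0 !trmx1.
  rewrite !mulmx_block !(mul0mx, mulmx0, mul1mx, mulmx1, addr0, add0r).
  rewrite -trmx_mul rg tr_row_mx trmx1 trmx0.
  by rewrite /A1 /congr_mx trmxK.
have PB : congr_mx P (block_mx 0 0 0 B) = block_mx 0 0 0 B1.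
  by rewrite congr_mx_diag /congr_mx !(mul0mx, mulmx0).
apply: (SDC_closure_congr Pu).
move: (real_pencil_congr Pu AB); move: Au; rewrite -(congr_mx_unit _ Pu) PA PB.
have [A0s A1E] := sym_blockE (congr_mx_sym (invmx g)^T As).
have [B0s B1E] := sym_blockE (congr_mx_sym (invmx g)^T Bs).
rewrite -/A1 -/B1 in A0s A1E B0s B1E.
rewrite A1E B1E; move: (ulsubmx A1) (ursubmx A1) (drsubmx A1) A0s => a s A0 A0s.
move: (ulsubmx B1) (ursubmx B1) (drsubmx B1) B0s => b c B0 B0s.
rewrite [a]mx11_scalar [b]mx11_scalar {A1E B1E} => Au1 AB1.
have [Q Qu [QA QB]] := congr_hyperbolic_clear (a 0 0) s A0.
apply: (SDC_closure_congr Qu).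
move: (real_pencil_congr Qu AB1); move: Au1; rewrite -(congr_mx_unit _ Qu) QA QB.
move=> Hu HB; have A0u : A0 \in unitmx.
  apply/unitmx_kerP => v vA; have /unitmx_kerP/(_ (row_mx 0 (row_mx 0 v))) := Hu.
  rewrite /hyperbolic !block_mxE vA !row_mx0 => /(_ erefl) /eqP.
  by rewrite !row_mx_eq0 => /and3P[_ _ /eqP].
by apply: SDC_closure_hyperbolic => //; exact: IH.
Qed.

Lemma real_pencil_SDC_closure n (A : 'M[R]_n) : A^T = A -> A \in unitmx -> approximable A.
Proof.
elim/ltn_ind: n A => -[|n] IH A As Au B Bs AB.
  apply: subset_closure; apply/SDC_pairP; exists 1%:M; first exact: unitmx1.
  by apply/andP; split; apply/is_diag_mxP => -[].
(* Subtracting a multiple of [A] from [B] moves the eigenvalue [a] to 0; then [v]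
   becomes the first basis vector. *)
have [a [v [v0 vB]]] := real_pencil_eigen (ltn0Sn n) Au AB.
apply: (@SDC_closure_shift _ _ _ _ (- a)).
have := real_pencil_shift (a := - a) AB.
have : (B + - a *: A)^T = B + - a *: A by rewrite linearD linearZ /= As Bs.
have : v *m (B + - a *: A) = 0.
  by rewrite mulmxDr vB -scalemxAr -scalerDl subrr scale0r.
move: (B + - a *: A) => {AB Bs a vB}B vB Bs AB.
have [Q Qu Qv] := @unitmx_first_row R n v v0.
apply: (SDC_closure_congr Qu); move: (real_pencil_congr Qu AB).
have [A0s AE] := sym_blockE (congr_mx_sym Q As).
have [B0s _] := sym_blockE (congr_mx_sym Q Bs).
have BE : congr_mx Q B = block_mx 0 0 0 (drsubmx (congr_mx Q B : 'M[R]_(1 + n))).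
  apply: sym_degenerateE; first exact: congr_mx_sym.
  by rewrite !mulmxA Qv vB mul0mx.
have QAu : congr_mx Q A \in unitmx by rewrite congr_mx_unit.
move: (drsubmx _) B0s BE => B0 B0s ->.
move: AE QAu; rewrite [ulsubmx _]mx11_scalar.
move: (ulsubmx _) (ursubmx _) (drsubmx _) A0s => a r A0 A0s -> {}Au {}AB.
have [a0|a0] := eqVneq (a 0 0) 0; last first.
  by apply: SDC_closure_nonisotropic => // A'; exact: IH.
move: Au AB; rewrite a0 (raddf0 (@scalar_mx R 1)) => {}Au {}AB.
(* Otherwise the first basis vector would be in the kernel of [A]. *)
have r0 : r != 0.
  apply/eqP => rE; have /unitmx_kerP/(_ (row_mx 1%:M 0)) := Au.
  rewrite rE mul_row_block !(mulmx0, mul0mx, addr0) row_mx0 => /(_ erefl)/eqP.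
  by rewrite row_mx_eq0 oner_eq0.
case: n r A0 B0 A0s B0s Au AB IH r0 {A B As Bs v v0 Q Qu Qv vB a a0} =>
    [|n] r A0 B0 A0s B0s Au AB IH r0.
  by rewrite thinmx0 eqxx in r0.
apply: SDC_closure_isotropic => // A'; exact: IH.
Qed.
End Main.

Theorem theorem1 (R : realType) (n : nat) (A B : 'M[R]_n)
    (symA : A \is symmetricmx) (symB : B \is symmetricmx)
    (unitA : A \in unitmx) :
  ASDC [set A; B] <-> has_real_eigenvalues (invmx A *m B).
Proof.
have As : A^T = A by apply/eqP; rewrite -symmetricmxE.
have Bs : B^T = B by apply/eqP; rewrite -symmetricmxE.
rewrite real_pencilP //; split=> [|AB]; first exact: ASDC_real_pencil.
have [u uSDC uB] := closure_seq (real_pencil_SDC_closure As unitA Bs AB).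
(* When [A = B] the second branch is never used, and the constant sequence is
   right for both. *)
exists (fun X i => if X == A then A else u i).
split=> [X _ i|X [->|->]|i].
- by case: ifP => // _; rewrite symmetricmxE (SDC_sym (uSDC i)).
- by under eq_fun do rewrite eqxx; exact: cvg_cst.
- case: eqP => [->|_]; first exact: cvg_cst.
  exact: uB.
have [Q Qu QAB] := uSDC i; exists Q => // _ [X _ <-]; apply: QAB.
by case: ifP; [left | right].
Qed.
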